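(* Let $G:\mathbb{R}\to\mathbb{R}$ be a function with $G\notin\mathsf{Tractable}$. Consider any deterministic algorithm that solves the $G$-Sum problem with relative error $\epsilon'=1/\log^b(nN)$, for some constant $b$. Such an algorithm must use space at least $\Omega(\log^a(nN))$, where $a$ can be taken arbitrarily large.
   Context: Streaming model: the universe is $[n]=\{1,\ldots,n\}$, and $N$ is an integer. A stream $D(n,N)$ is a sequence of elements of $[n]$ arriving over discrete time steps. The model is the timestamp-based sliding window model: any number of elements may arrive or expire per time step. The current window $W$ consists of the most recent (active) elements, and $N$ bounds the window size. The frequency vector is $M(W)=(m_1,\ldots,m_n)$, where $m_i$ is the number of active occurrences of $i$. $G$-Sum problem: for every stream and every current window $W$, output a $(1\pm\epsilon)$-approximation of $\sum_{i=1}^n G(m_i)$. Here $x$ is a $(1\pm\epsilon)$-approximation of $y$ if $(1-\epsilon)y\le x\le(1+\epsilon)y$. Local jump: for $\epsilon>0$ and $x\in\mathbb{N}$, $\pi_\epsilon(x)=\min\{x,\ \min\{z\in\mathbb{N}: G(x+z)>(1+\epsilon)G(x)\text{ or }G(x-z)<(1-\epsilon)G(x)\}\}$. $\mathsf{Tractable}$: $G$ is tractable if $G(1)>0$ and both of the following hold. (i) For every $k$ there exist $N_0,t$ such that for all $x,y\in\mathbb{N}^+$, $R\in\mathbb{R}^+$ and $\epsilon$: if $R>N_0$, $G(x)/G(y)=R$ and $\epsilon>1/\log^k(Rx)$, then $(\pi_\epsilon(x)/y)^2\ge R/\log^t(Rx)$. (ii) For every $k$ there exist $r,N_1$ such that for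 all $x\ge N_1$ and all $\epsilon>1/\log^k(x)$, we have $\pi_\epsilon(x)\ge x/\log^r(x)$.
   Formalization: Assumes G is not identically zero on the naturals and b > 0 (otherwise constantly answering 0 can solve the problem with no memory), and reads Ω as holding for infinitely many pairs with n and N both arbitrarily large, since for fixed n it can fail. *)

(* Defs.v *)
From HB Require Import structures.
From mathcomp Require Import all_boot all_order all_algebra.
From mathcomp Require Import all_classical all_reals all_analysis.

Set Implicit Arguments.
Unset Strict Implicit.
Unset Printing Implicit Defensive.

Import Order.TTheory GRing.Theory Num.Theory.
Local Open Scope ring_scope.

Definition jumps (R : realType) (G : R -> R) (eps : R) (x z : nat) : bool :=
  (G (x%:R + z%:R) > (1 + eps) * G x%:R)
  || (G (x%:R - z%:R) < (1 - eps) * G x%:R).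

(* min {x, min {z | jumps G eps x z}}: jumps z >= x cannot lower the value, and
   the default value x covers the case where there is no jump at all. *)
Definition local_jump (R : realType) (G : R -> R) (eps : R) (x : nat) : nat :=
  \big[minn/x]_(z < x | jumps G eps x z) (z : nat).

(* Since r > 0 and y / 0 = 0, the equation G x / G y = r forces G y != 0. *)
Definition tractable_growth (R : realType) (G : R -> R) : Prop :=
  forall k : nat, exists N0 t : nat,
  forall (x y : nat) (r eps : R),
    (0 < x)%N -> (0 < y)%N -> 0 < r -> 0 < eps ->
    N0%:R < r -> G x%:R / G y%:R = r -> 1 / ln (r * x%:R) ^+ k < eps ->
    r / ln (r * x%:R) ^+ t <= ((local_jump G eps x)%:R / y%:R) ^+ 2.

Definition tractable_jump (R : realType) (G : R -> R) : Prop :=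
  forall k : nat, exists r N1 : nat,
  forall (x : nat) (eps : R),
    (N1 <= x)%N -> 0 < eps -> 1 / ln x%:R ^+ k < eps ->
    x%:R / ln x%:R ^+ r <= (local_jump G eps x)%:R :> R.

Definition Tractable (R : realType) (G : R -> R) : Prop :=
  [/\ 0 < G 1, tractable_growth G & tractable_jump G].

(* [Some i] is the arrival of the element i in the current time step, [None] is
   the clock tick that starts the next time step. Any number of arrivals may
   occur between two ticks. *)
Definition stream (n : nat) : Type := seq (option 'I_n).

(* The window of duration w: the elements that arrived during the last w time
   steps (the current one included), i.e. those followed by fewer than w ticks.
   One tick can expire any number of elements. *)
Fixpoint window (n w : nat) (D : stream n) : seq 'I_n :=
  match D with
  | [::] => [::]
  | e :: D' =>
      match e with
      | Some i => if (count_mem None D' < w)%N then i :: window w D'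
                  else window w D'
      | None => window w D'
      end
  end.

Definition window_bounded (n N w : nat) (D : stream n) : Prop :=
  forall k : nat, (size (window w (take k D)) <= N)%N.

Definition freq (n w : nat) (D : stream n) (i : 'I_n) : nat :=
  count_mem i (window w D).

Definition GSum (R : realType) (G : R -> R) (n w : nat) (D : stream n) : R :=
  \sum_(i < n) G (freq w D i)%:R.

Definition approximates (R : realType) (eps x y : R) : Prop :=
  (1 - eps) * y <= x <= (1 + eps) * y.

(* A deterministic streaming algorithm over the universe 'I_n whose memory
   consists of [space_bits] bits; neither the time to process an update nor the
   computation of the answer from the memory is restricted. *)
Record algorithm (R : realType) (n : nat) := Algorithm {
  space_bits : nat;
  alg_init : space_bits.-tuple bool;
  alg_step : space_bits.-tuple bool -> option 'I_n -> space_bits.-tuple bool;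
  alg_output : space_bits.-tuple bool -> R
}.

Definition run_alg (R : realType) (n : nat) (A : algorithm R n) (D : stream n) : R :=
  alg_output (foldl (@alg_step R n A) (alg_init A) D).

(* The streams are all the finite histories, so the answer is required to be
   correct at every moment. *)
Definition solves_GSum (R : realType) (G : R -> R) (n N w : nat) (eps : R)
    (A : algorithm R n) : Prop :=
  forall D : stream n, window_bounded N w D ->
    approximates eps (run_alg A D) (GSum G w D).

(* S = Omega(f) in the sense of Hardy and Littlewood, i.e. S is not o(f): the
   bound S >= c f holds for pairs with both n and N arbitrarily large. It cannot
   be asked of all large pairs (for N = 1 or n = 1 the problem may be easy). *)
Definition is_Omega (R : realType) (S f : nat -> nat -> R) : Prop :=
  exists2 c : R, 0 < c &
    forall B : nat, exists n N : nat,
      [/\ (B <= n)%N, (B <= N)%N & c * f n N <= S n N].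

(* Main.v *)
(* If G is affine on the naturals, then it is tractable. Otherwise some second
   difference G p - 2 G (p+1) + G (p+2) is nonzero, and then a deterministic
   algorithm of small error needs space linear in the number n of elements, even
   on streams without expirations in which all frequencies are at most p + 2.
   Indeed, encode the words of {0,1}^h as frequency vectors. By pigeonhole and a
   bound on the volume of Hamming balls, an algorithm of too small space confuses
   two words x and y at a distance proportional to h. Now add p + x to both
   frequency vectors. On the coordinates where the two words agree the
   frequencies become p or p + 2, on the others they become p + 1; so the two
   sums differ by a constant fraction. *)
Require Import Defs.
From HB Require Import structures.
From mathcomp Require Import all_boot all_order all_algebra.
From mathcomp Require Import all_classical all_reals all_analysis.
From mathcomp Require Import zify ring lra.

Set Implicit Arguments.
Unset Strict Implicit.
Unset Printing Implicit Defensive.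

Import Order.TTheory GRing.Theory Num.Theory.
Local Open Scope ring_scope.

(** * Binary words: ball volumes and collisions *)

Section BallVolume.
Local Open Scope nat_scope.

Definition agreement (h : nat) (x y : {ffun 'I_h -> bool}) : nat :=
  #|[pred i | x i == y i]|.

(** The sum factors over the coordinates, each contributing 2 + 1. This exponential moment takes the
    place of estimates of binomial sums. *)
Lemma sum_exp2_agreement (h : nat) (x : {ffun 'I_h -> bool}) :
  \sum_(y : {ffun 'I_h -> bool}) 2 ^ agreement x y = 3 ^ h.
Proof.
transitivity (\sum_(y : {ffun 'I_h -> bool})
    \prod_(i < h) (if x i == y i then 2 else 1)).
  apply: eq_bigr => y _; rewrite -big_mkcond /= prod_nat_const.
  by congr (2 ^ _); apply: eq_card.
rewrite -(bigA_distr_bigA (fun (i : 'I_h) c => if x i == c then 2 else 1)).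
rewrite (eq_bigr (fun=> 3)) ?prod_nat_const ?card_ord// => i _.
by rewrite big_bool; case: (x i).
Qed.

(** A Chernoff-type argument: compared with one of its words, every word of a fiber weighs at least
    [2 ^ k] in the moment [3 ^ h]. Summing over the at most [#|T|] fibers counts all [2 ^ h]
    words. *)
Lemma fiber_agreement_bound (h k : nat) (T : finType)
    (phi : {ffun 'I_h -> bool} -> T) :
  (forall x y, phi x = phi y -> k <= agreement x y) ->
  2 ^ (h + k) <= #|T| * 3 ^ h.
Proof.
move=> agr.
have -> : 2 ^ (h + k) = \sum_(x : {ffun 'I_h -> bool}) 2 ^ k.
  by rewrite sum_nat_const card_ffun card_bool card_ord expnD.
rewrite (partition_big phi xpredT)//= -sum_nat_const.
apply: leq_sum => t _.
case: (pickP (fun x => phi x == t)) => [x0 /eqP x0t|none]; last first.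
  by rewrite big_pred0.
rewrite -(sum_exp2_agreement x0) [leqRHS](bigID (fun x => phi x == t))/=.
apply: leq_trans (leq_addr _ _); apply: leq_sum => x /eqP xt.
by rewrite leq_exp2l// agr// xt.
Qed.

(* The constants 4 and 3 work because 2 * (3 ^ 4) ^ 2 <= (2 ^ (4 + 3)) ^ 2. *)
Lemma low_agreement_collision (m s : nat)
    (phi : {ffun 'I_(4 * m) -> bool} -> s.-tuple bool) :
  2 * s < m ->
  exists x y, phi x = phi y /\ agreement x y < 3 * m.
Proof.
move=> sm; apply/not_existsP => none.
have : 2 ^ (4 * m + 3 * m) <= #|{: s.-tuple bool}| * 3 ^ (4 * m).
  apply: (fiber_agreement_bound (phi := phi)) => x y xy; rewrite leqNgt.
  by apply/negP => xy3; apply: (none x); exists y.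
rewrite card_tuple card_bool -mulnDl expnM (expnM 3) => bound.
have : 2 ^ m * (81 ^ m * 81 ^ m) <= 2 ^ (2 * s) * (81 ^ m * 81 ^ m).
  apply: leq_trans (_ : (2 ^ 7) ^ m * (2 ^ 7) ^ m <= _).
    by rewrite -!expnMn leq_exp2r//; case: (m) sm.
  by rewrite mul2n -addnn expnD mulnACA; apply: leq_mul.
by rewrite leq_pmul2r ?muln_gt0 ?expn_gt0// leq_exp2l// leqNgt sm.
Qed.

End BallVolume.

(** * Streams without ticks realizing a given frequency vector *)

Section Stream.
Variables (n : nat).
Implicit Types (f g y : 'I_n -> nat).
Local Open Scope nat_scope.

Definition arrivals f : seq 'I_n := flatten [seq nseq (f i) i | i <- enum 'I_n].

Lemma count_arrivals f i : count_mem i (arrivals f) = f i.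
Proof.
rewrite count_flatten -map_comp sumnE big_map big_enum/= (bigD1 i)//=.
rewrite count_nseq/= eqxx mul1n big1 ?addn0// => j /negPf ji.
by rewrite count_nseq/= ji.
Qed.

Lemma size_arrivals f : size (arrivals f) = \sum_(i < n) f i.
Proof.
rewrite size_flatten /shape -map_comp sumnE big_map big_enum/=.
by apply: eq_bigr => i _; rewrite size_nseq.
Qed.

Lemma window_no_tick w (s : seq 'I_n) : 0 < w -> window w (map some s) = s.
Proof.
move=> w0; elim: s => //= i s ->.
by rewrite (_ : count_mem None _ = 0) ?w0//; elim: s.
Qed.

Lemma window_bounded_no_tick N w (s : seq 'I_n) :
  0 < w -> size s <= N -> window_bounded N w (map some s).
Proof.
move=> w0 sN k; rewrite -map_take window_no_tick//.
by apply: leq_trans sN; rewrite size_take; case: ltnP => // /ltnW.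
Qed.

End Stream.

(** * Equal memory states and the second difference of [G] *)

Section SameState.
Variables (R : realType) (G : R -> R).

Lemma GSum_arrivals n w (f y : 'I_n -> nat) : (0 < w)%N ->
  GSum G w (map some (arrivals f ++ arrivals y)) =
  \sum_(i < n) G (f i + y i)%:R.
Proof.
move=> w0; apply: eq_bigr => i _.
by rewrite /freq window_no_tick// count_cat !count_arrivals.
Qed.

(** From a common state, the common continuation [y] leads to a single output, which has to
    approximate both sums. *)
Lemma GSum_close_of_same_state n N w eps (A : algorithm R n) (f g y : 'I_n -> nat) :
  (0 < w)%N -> solves_GSum G N w eps A ->
  (\sum_(i < n) (f i + y i) <= N)%N -> (\sum_(i < n) (g i + y i) <= N)%N ->
  foldl (@alg_step R n A) (alg_init A) (map some (arrivals f)) =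
  foldl (@alg_step R n A) (alg_init A) (map some (arrivals g)) ->
  `|\sum_(i < n) G (f i + y i)%:R - \sum_(i < n) G (g i + y i)%:R| <=
    eps * (\sum_(i < n) G (f i + y i)%:R + \sum_(i < n) G (g i + y i)%:R).
Proof.
move=> w0 solve fN gN fg.
pose S f := \sum_(i < n) G (f i + y i)%:R; rewrite -/(S f) -/(S g).
have approx h : (\sum_(i < n) (h i + y i) <= N)%N ->
    approximates eps (run_alg A (map some (arrivals h ++ arrivals y))) (S h).
  move=> hN; rewrite /S -(GSum_arrivals _ _ w0); apply: solve.
  apply: window_bounded_no_tick => //.
  by rewrite size_cat !size_arrivals -big_split.
have := approx _ gN; have := approx _ fN.
rewrite /run_alg !map_cat !foldl_cat fg => /andP[f1 f2] /andP[g1 g2].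
by rewrite ler_norml; apply/andP; split; lra.
Qed.

(* Every bit is coded by one of the pairs (0, 1) and (1, 0); hence all words have
   the same weight and the sums below depend only on the distance of the words. *)
Definition codeword h (x : {ffun 'I_h -> bool}) (i : 'I_(h + h)) : nat :=
  match fintype.split i with inl j => x j | inr j => ~~ x j end.

Lemma codeword_le1 h (x : {ffun 'I_h -> bool}) i : (codeword x i <= 1)%N.
Proof. by rewrite /codeword; case: (fintype.split i) => j; case: (x j). Qed.

(** The two coordinates of a bit get frequencies [p] and [p.+2] if the words agree there, and [p.+1]
    twice if they differ. *)
Lemma sum_codeword h (p : nat) (x y : {ffun 'I_h -> bool}) :
  \sum_(i < h + h) G (codeword y i + (p + codeword x i))%:R =
  (G p%:R + G p.+2%:R) * (agreement x y)%:R
  + 2 * G p.+1%:R * (h%:R - (agreement x y)%:R).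
Proof.
rewrite big_split_ord/= -big_split/=.
rewrite (eq_bigr (fun j => if x j == y j then G p%:R + G p.+2%:R
                           else 2 * G p.+1%:R)); last first.
  move=> j _; rewrite /codeword.
  rewrite (unsplitK (inl j)) (unsplitK (inr j)).
  case: (x j); case: (y j) => /=;
    rewrite ?addn0 ?add0n ?addn1 ?add1n ?mulr_natl ?mulr2n//.
  by rewrite addrC.
rewrite (bigID (fun j => x j == y j))/=; congr (_ + _).
  rewrite (eq_bigr (fun=> G p%:R + G p.+2%:R)); last by move=> j ->.
  by rewrite sumr_const mulr_natr.
rewrite (eq_bigr (fun=> 2 * G p.+1%:R)); last by move=> j /negPf ->.
rewrite -natrB; last by rewrite -[leqRHS]card_ord max_card.
rewrite sumr_const -[LHS]mulr_natr; congr (_ * _%:R).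
have := cardC [pred j | x j == y j]; rewrite card_ord => hE.
by rewrite -{}[RHS](congr1 (subn^~ _) hE) addKn; apply: eq_card.
Qed.

Lemma small_space_curvature m N w eps p
    (A : algorithm R (4 * m + 4 * m)) :
  (forall k : nat, 0 <= G k%:R) -> 0 <= eps ->
  (0 < w)%N -> solves_GSum G N w eps A ->
  (p.+2 * (4 * m + 4 * m) <= N)%N -> (2 * space_bits A < m)%N ->
  `|2 * G p.+1%:R - (G p%:R + G p.+2%:R)|
    <= eps * 8 * (2 * G p.+1%:R + (G p%:R + G p.+2%:R)).
Proof.
move=> G0 eps0 w0 solve NE sm.
have [x [y [xy agr]]] := low_agreement_collision (fun x =>
  foldl (@alg_step R _ A) (alg_init A) (map some (arrivals (codeword x)))) sm.
have sizeN z : (\sum_(i < 4 * m + 4 * m)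
    (codeword z i + (p + codeword x i)) <= N)%N.
  apply: leq_trans NE.
  apply: leq_trans (_ : \sum_(i < 4 * m + 4 * m) p.+2 <= _)%N; last first.
    by rewrite sum_nat_const card_ord mulnC.
  apply: leq_sum => i _.
  by have := codeword_le1 x i; have := codeword_le1 z i; lia.
have := GSum_close_of_same_state w0 solve (sizeN x) (sizeN y) xy.
rewrite !sum_codeword.
have -> : agreement x x = (4 * m)%N.
  by rewrite -[RHS]card_ord; apply: eq_card => i; rewrite !inE eqxx.
have := G0 p; have := G0 p.+1; have := G0 p.+2.
move: (G p%:R) (G p.+1%:R) (G p.+2%:R) => a0 a1 a2 a20 a10 a00.
have m0 : 0 < m%:R :> R by rewrite ltr0n; lia.
have : (agreement x y)%:R <= 3 * m%:R :> R by rewrite -natrM ler_nat ltnW.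
have : 0 <= (agreement x y)%:R :> R by [].
rewrite natrM; move: (agreement x y)%:R (m%:R) m0 => c M M0 c0 cM.
(* As [c <= 3 * M], the two sums differ by at least [M] times the second difference. *)
rewrite (_ : _ - _ = (4 * M - c) * (a0 + a2 - 2 * a1)); last by ring.
rewrite normrM (ger0_norm (_ : 0 <= 4 * M - c)); last lra.
rewrite distrC => H; rewrite -(ler_pM2l M0).
have nge0 : 0 <= `|2 * a1 - (a0 + a2)| by [].
have : M * `|2 * a1 - (a0 + a2)| <= (4 * M - c) * `|2 * a1 - (a0 + a2)|.
  by apply: ler_wpM2r => //; lra.
move=> /le_trans; apply; apply: (le_trans H).
(* The factor 8 comes from the total of the two sums, [(a0 + a2) * (4 * M + c) + 2 * a1 * (4 * M -
   c)], where [4 * M + c <= 7 * M]. *)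
rewrite [leRHS](_ : _ = eps * (M * 8 * (2 * a1 + (a0 + a2)))); last by ring.
apply: ler_wpM2l => //.
suff : (a0 + a2) * c <= (a0 + a2) * (3 * M) /\ 0 <= a1 * c /\
    0 <= a1 * M /\ 0 <= a0 * M /\ 0 <= a2 * M by lra.
by repeat split; [apply: ler_wpM2l; lra| | | |]; apply: mulr_ge0 => //; exact: ltW.
Qed.

End SameState.

(** * Powers of the logarithm *)

Section LnPowers.
Variable R : realType.

(** For a > 0, [x] is the a-th power of exp(ln x / a), and exp t >= t. *)
Lemma ln_expn_le (a : nat) (x : R) : 1 <= x -> ln x ^+ a <= a%:R ^+ a * x.
Proof.
case: a => [|a] x1; first by rewrite !expr0 mul1r.
have x0 : 0 < x by exact: lt_le_trans ltr01 x1.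
have l0 : 0 <= ln x by exact: ln_ge0.
have a0 : a.+1%:R != 0 :> R by rewrite pnatr_eq0.
rewrite -{2}[x]lnK ?posrE// -[X in expR X](divfK a0).
rewrite expRM_natr -exprMn lerXn2r ?nnegrE ?mulr_ge0 ?expR_ge0//.
rewrite -ler_pdivrMl ?ltr0n// mulrC.
by apply: le_trans (expR_ge1Dx _); rewrite lerDr.
Qed.

Lemma one_le_ln (x : R) : 4 <= x -> 1 <= ln x.
Proof.
move=> x4; apply: le_trans (_ : ln 4 <= _); last first.
  by rewrite ler_ln ?posrE//; lra.
(* ln 4 = -2 ln(1/2), and ln(1 + t) <= t at t = -1/2 gives at least 1. *)
have -> : 4 = 2 ^+ 2 :> R by ring.
rewrite lnXn// -[X in ln X]invrK lnV ?posrE ?invr_gt0//.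
have h1 : -1 < - 2^-1 :> R by lra.
have := le_ln1Dx h1; rewrite (_ : 1 + - 2^-1 = 2^-1); last by field.
by rewrite -[X in _ -> _ <= X]mulr_natr; lra.
Qed.

Lemma inv_ln_powR_small (b d : R) : 0 < b -> 0 < d ->
  exists M : nat, forall q : nat, (M <= q)%N -> 1 / (ln q%:R `^ b) < d.
Proof.
move=> b0 d0; pose T := d^-1 `^ b^-1.
have T0 : 0 <= T by exact: powR_ge0.
exists (Num.trunc (expR T)).+1 => q Mq.
have qT : expR T < q%:R.
  by apply: lt_le_trans (truncnS_gt _) _; rewrite ler_nat.
have Tln : T < ln q%:R.
  by rewrite -ltr_expR lnK ?posrE//; exact: lt_trans (expR_gt0 _) qT.
have : T `^ b < ln q%:R `^ b.
  by apply: gt0_ltr_powR => //; rewrite ?nnegrE//; exact: ltW (le_lt_trans T0 Tln).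
rewrite -powRrM mulVf ?gt_eqF// powRr1 ?invr_ge0 ?ltW// => dln.
rewrite div1r invf_plt ?posrE//.
by apply: lt_trans dln; rewrite invr_gt0.
Qed.

End LnPowers.

(** * Affine functions are tractable *)

Section Affine.
Variables (R : realType) (G : R -> R).

(** A shift by [z] changes the value by [al * z], so a jump needs [al * z > eps * (al * x + be)],
    which forces [z > eps * x]. The default value [x] is covered by [e <= 1]. *)
Lemma local_jump_affine_ge (al be e eps : R) (x : nat) :
  0 <= al -> 0 <= be -> (forall k : nat, G k%:R = al * k%:R + be) ->
  0 < e -> e <= 1 -> e <= eps -> e * x%:R <= (local_jump G eps x)%:R.
Proof.
move=> al0 be0 GE e0 e1 eeps; rewrite /local_jump.
elim/big_ind: _ => [|u v|z].
- by rewrite ler_piMl.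
- by rewrite /minn; case: ifP.
rewrite /jumps -natrD -natrB ?(ltnW (ltn_ord z))// !GE natrD natrB; last first.
  exact: ltnW (ltn_ord z).
move: (z : nat)%:R (x%:R) (ler0n R z) (ler0n R x) => Z X Z0 X0 jump.
rewrite leNgt; apply/negP => Zlt.
have : al * Z <= eps * (al * X + be).
  have : al * Z <= al * (eps * X).
    apply: ler_wpM2l => //; apply: ltW; apply: lt_le_trans Zlt _.
    by apply: ler_wpM2r.
  have : 0 <= eps * be by apply: mulr_ge0 => //; exact: le_trans (ltW e0) eeps.
  lra.
by case/orP: jump; lra.
Qed.

Lemma second_difference_affine :
  (forall p : nat, 2 * G p.+1%:R = G p%:R + G p.+2%:R) ->
  forall k : nat, G k%:R = (G 1 - G 0) * k%:R + G 0.
Proof.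
move=> G2 k; suff [] : G k%:R = (G 1 - G 0) * k%:R + G 0 /\
    G k.+1%:R = (G 1 - G 0) * k.+1%:R + G 0 by [].
elim: k => [|k [IH0 IH1]]; first by split; rewrite ?mulr0n ?mulr1n; lra.
split=> //; have := G2 k; rewrite IH0 IH1 -!natr1; lra.
Qed.

Lemma affine_tractable :
  (forall k : nat, 0 <= G k%:R) -> (exists k : nat, G k%:R != 0) ->
  (forall p : nat, 2 * G p.+1%:R = G p%:R + G p.+2%:R) -> Tractable G.
Proof.
move=> G0 Gn0 /second_difference_affine.
set al := G 1 - G 0; set be := G 0 => GE.
have be0 : 0 <= be by exact: (G0 0).
have al0 : 0 <= al.
  rewrite leNgt; apply/negP => al0.
  (* With a negative slope, [G] would be negative at the first integer beyond its zero. *)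
  have := truncnS_gt (be / - al); rewrite ltr_pdivrMr ?oppr_gt0//.
  by have := G0 (Num.trunc (be / - al)).+1; rewrite GE; lra.
have G1 : 0 < G 1.
  rewrite lt_neqAle (G0 1) andbT eq_sym; apply/negP => /eqP G10.
  case: Gn0 => k /eqP; apply; rewrite GE.
  have be00 : be = 0 by move: al0; rewrite /al G10 -/be; lra.
  by rewrite /al G10 -/be be00 subrr mul0r addr0.
split=> // k.
  (* The bound 4 makes the logarithm at least 1; the local jump loses a factor [ln ^+ k], which is
     then squared. *)
  exists 4, (2 * k)%N => x y r eps x0 y0 r0 eps0 r4 rE epsk.
  have Gy0 : 0 < G y%:R.
    rewrite lt_neqAle G0 andbT; apply/negP => /eqP Gy.
    by move: r0; rewrite -rE -Gy invr0 mulr0 ltxx.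
  have X1 : 1 <= x%:R :> R by rewrite ler1n.
  have Y0 : 0 < y%:R :> R by rewrite ltr0n.
  (* Since [be >= 0] and [r > 1], a ratio [r] of values needs at least a ratio [r] of arguments.
     Slope 0 would give [r = 1]. *)
  have ry : r * y%:R <= x%:R.
    have : r * G y%:R = G x%:R by rewrite -rE divfK ?gt_eqF.
    rewrite !GE leNgt => E; apply/negP => xry.
    have al_gt0 : 0 < al.
      rewrite lt_neqAle al0 andbT; apply/negP => /eqP al00.
      move: E Gy0; rewrite !GE -al00 !mul0r !add0r => E b0.
      by move: r4; rewrite -(ltr_pM2r b0) E; lra.
    have : al * x%:R < al * (r * y%:R) by rewrite ltr_pM2l.
    have : be <= r * be by rewrite ler_peMl//; lra.
    lra.
  have L1 : 1 <= ln (r * x%:R).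
    apply: one_le_ln; apply: le_trans (ltW r4) _.
    by rewrite ler_peMr// ltW.
  have Lk : 1 <= ln (r * x%:R) ^+ k by exact: exprn_ege1.
  have := @local_jump_affine_ge al be (ln (r * x%:R) ^+ k)^-1 eps x al0 be0 GE.
  rewrite invr_gt0 invf_le1 ?(lt_le_trans ltr01 Lk)// -div1r.
  move=> /(_ isT Lk (ltW epsk)) jump.
  rewrite mulnC exprM.
  move: (ln _ ^+ k) (local_jump G eps x)%:R Lk jump => L J Lk jump.
  have L0 : 0 < L by exact: lt_le_trans ltr01 Lk.
  have rJ : r / L <= J / y%:R.
    rewrite ler_pdivlMr//; apply: le_trans jump.
    by rewrite mulrAC div1r mulrC ler_wpM2l// invr_ge0 ltW.
  apply: le_trans (_ : (r / L) ^+ 2 <= _).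
    rewrite expr_div_n ler_wpM2r ?invr_ge0 ?exprn_ge0 ?(ltW L0)//.
    by rewrite expr2 ler_peMr ?(ltW r0)//; lra.
  have rL : 0 <= r / L by rewrite divr_ge0 ?ltW.
  by rewrite ler_sqr// nnegrE//; exact: le_trans rL rJ.
exists k, 4 => x eps x4 eps0 epsk.
have Lk : 1 <= ln (x%:R : R) ^+ k.
  by apply/exprn_ege1/one_le_ln; rewrite (ler_nat R 4).
have := @local_jump_affine_ge al be (ln (x%:R : R) ^+ k)^-1 eps x al0 be0 GE.
rewrite invr_gt0 invf_le1 ?(lt_le_trans ltr01 Lk)// -div1r.
move=> /(_ isT Lk (ltW epsk)).
by rewrite div1r mulrC.
Qed.

End Affine.

(* For y < 0 the interval [(1 - eps) y, (1 + eps) y] is empty. *)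
Lemma solvable_nonneg (R : realType) (G : R -> R) (w : nat -> nat -> nat)
    (eps : nat -> nat -> R) (A : forall n N : nat, algorithm R n) :
  (forall n N, (0 < w n N)%N) ->
  (forall n N, (1 < n * N)%N -> 0 < eps n N) ->
  (forall n N, (1 < n * N)%N -> solves_GSum G N (w n N) (eps n N) (A n N)) ->
  forall k : nat, 0 <= G k%:R.
Proof.
move=> w0 eps0 solve k; rewrite leNgt; apply/negP => Gk.
(* One element arriving [k] times suffices; the window bound [k.+2] also makes the product exceed
   1. *)
have N1 : (1 < 1 * k.+2)%N by rewrite mul1n.
have size_k : (size (arrivals (fun=> k) : seq 'I_1) <= k.+2)%N.
  by rewrite size_arrivals big_ord1; lia.
have := solve _ _ N1 _ (window_bounded_no_tick (w0 _ _) size_k).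
have -> : GSum G (w 1 k.+2) (map some (arrivals (fun=> k) : seq 'I_1)) = G k%:R.
  by rewrite /GSum big_ord1 /freq window_no_tick// count_arrivals.
case/andP=> le1 le2; have := le_trans le1 le2.
have : eps 1 k.+2 * G k%:R < 0 by rewrite pmulr_rlt0// eps0.
lra.
Qed.

Theorem theorem3 (R : realType) (G : R -> R)
  (G_not_null : exists m : nat, G m%:R != 0)
  (G_not_tractable : ~ Tractable G)
  (w : nat -> nat -> nat) (w_gt0 : forall n N : nat, (0 < w n N)%N)
  (b : R) (b_gt0 : 0 < b)
  (A : forall n N : nat, algorithm R n)
  (A_solves : forall n N : nat, (1 < n * N)%N ->
     solves_GSum G N (w n N) (1 / (ln (n * N)%:R `^ b)) (A n N))
  (a : nat) :
  is_Omega (fun n N => (space_bits (A n N))%:R : R)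
    (fun n N => ln (n * N)%:R ^+ a).
Proof.
have eps_gt0 n N : (1 < n * N)%N -> 0 < 1 / (ln (n * N)%:R `^ b) :> R.
  by move=> nN; rewrite div1r invr_gt0 powR_gt0// ln_gt0// ltr1n.
have G_ge0 := solvable_nonneg w_gt0 eps_gt0 A_solves.
have [p Gp] : exists p : nat, 2 * G p.+1%:R != G p%:R + G p.+2%:R.
  apply/not_existsP => affine; apply: G_not_tractable.
  by apply: affine_tractable => // p; apply/eqP/negPn/negP/affine.
pose del := `|2 * G p.+1%:R - (G p%:R + G p.+2%:R)|.
pose tot := 2 * G p.+1%:R + (G p%:R + G p.+2%:R).
have del_gt0 : 0 < del by rewrite normr_gt0 subr_eq0.
have tot_ge0 : 0 <= tot.
  by have := G_ge0 p; have := G_ge0 p.+1; have := G_ge0 p.+2; rewrite /tot; lra.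
have tot1_gt0 : 0 < 8 * tot + 1 by lra.
(* Beyond [M] the error is too small for [del <= eps * 8 * tot]; the summand 1 keeps the denominator
   positive. *)
have [M small] := inv_ln_powR_small b_gt0 (divr_gt0 del_gt0 tot1_gt0).
(* The factors come from [n * N <= N ^ 2], from [ln_expn_le], and from [N = p.+2 * (8 * m)] with [m]
   at most twice the space. *)
pose C : R := (2 ^ a * a ^ a * (16 * p.+2))%:R.
have C_gt0 : 0 < C by rewrite ltr0n !muln_gt0 !expn_gt0; case: (a).
exists C^-1; first by rewrite invr_gt0.
move=> B; pose m := maxn (maxn B M) 1; pose n := (4 * m + 4 * m)%N.
have [mB mM m1] : [/\ B <= m, M <= m & 0 < m]%N by rewrite /m; split; lia.
pose N := (p.+2 * n)%N; exists n, N; split; [rewrite /n|rewrite /N /n|]; try lia.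
have space : (m <= 2 * space_bits (A n N))%N.
  rewrite leqNgt; apply/negP => sm.
  have nN : (1 < n * N)%N by rewrite /N /n; nia.
  have := small_space_curvature G_ge0 (ltW (eps_gt0 _ _ nN)) (w_gt0 n N)
            (A_solves n N nN) (leqnn _) sm.
  rewrite -/del -/tot => del_le.
  have MnN : (M <= n * N)%N by rewrite /N /n; nia.
  have := small _ MnN; rewrite ltr_pdivlMr//; have := eps_gt0 _ _ nN; lra.
have q1 : 1 <= N%:R :> R by rewrite ler1n /N /n; nia.
rewrite ler_pdivrMl//.
have nN0 : 0 < (n * N)%:R :> R by rewrite ltr0n /N /n; nia.
apply: le_trans (_ : (2 * ln N%:R) ^+ a <= _).
  apply: lerXn2r; rewrite ?nnegrE ?mulr_ge0 ?ln_ge0//.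
    by rewrite ler1n /N /n; nia.
  rewrite mulr_natl -lnXn ?ler_ln ?posrE ?exprn_gt0 ?(lt_le_trans ltr01 q1)//.
  by rewrite -natrX ler_nat /N; nia.
rewrite exprMn; apply: le_trans (_ : 2 ^+ a * (a%:R ^+ a * N%:R) <= _).
  by rewrite ler_wpM2l ?exprn_ge0// ln_expn_le.
rewrite /C -!natrX -!natrM ler_nat -!mulnA.
do 2 apply: leq_mul => //.
by move: (space_bits _) space => s; rewrite /N /n; nia.
Qed.
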